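(* In the variety of ternary rings, the elements of amalgamated free products have unique normal forms with respect to the representation $(\mathfrak{F},\Sigma')$ given in the context. That is: let $I$ be a nonempty set, let $(A_i)_{i\in I}$ be a family of ternary rings, let $B$ be a subalgebra of every $A_i$, with $A_i\cap A_j=B$ for distinct $i,j\in I$ and with every $A_i$ disjoint from the signature $\mathfrak{F}=\{t,q,0,1\}$ and from the set $X$ of variables, and let $A$ be the free product of the algebras $A_i$ with the amalgamated subalgebra $B$ in the variety of ternary rings. Then every element of $A$ has a unique normal form, i.e. is represented by exactly one term $\tau$ over $\bigcup_{i\in I}A_i$ such that there is no term $\tau'$ with $\tau\rightsquigarrow\tau'$, where $\rightsquigarrow$ is the rewriting relation defined in the context.
   Context: A ternary ring is an algebra of signature $\mathfrak{F}$, consisting of two ternary operation symbols $t,q$ and two nullary operation symbols $0,1$, which satisfies $t(0,x,y)=y$, $t(x,0,y)=y$, $t(1,x,0)=x$, $t(x,1,0)=x$, $q(x,y,t(x,y,z))=z$, $t(x,y,q(x,y,z))=z$. (Equivalently: a set with a ternary operation $t$ and constants $0,1$ satisfying the first four identities and such that for all $a,b,c$ there is a unique $x$ with $t(a,b,x)=c$; then $q(a,b,c)$ is this $x$. The case $0=1$ is allowed.) Let $X$ be a countable set of variables, disjoint from $\mathfrak{F}$. Let $\Sigma'$ be the following set of ten identities with variables in $X$, oriented from left to right; it also determines the variety of ternary rings: $t(0,x,y)=y$; $t(x,0,y)=y$; $t(1,x,0)=x$; $t(x,1,0)=x$; $q(x,y,t(x,y,z))=z$; $t(x,y,q(x,y,z))=z$;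 $q(0,x,y)=y$; $q(x,0,y)=y$; $q(1,x,x)=0$; $q(x,1,x)=0$. The conditions that $A_i\cap A_j=B$ for distinct $i,j$ and that $A_i\cap X=A_i\cap\mathfrak{F}=\emptyset$ are assumed without loss of generality. The free product $A$ of the $A_i$ with the amalgamated subalgebra $B$ is the colimit (multiple pushout) in the variety of ternary rings of the inclusions $B\to A_i$. Terms over $\bigcup_{i\in I}A_i$ are the formal expressions built from the elements of $\bigcup_{i\in I}A_i$ using the operation symbols of $\mathfrak{F}$ (including the nullary symbols $0$ and $1$). For terms $\tau,\tau'$ over $\bigcup_{i\in I}A_i$ write $\tau\rightsquigarrow\tau'$ if one of the following conditions is satisfied: (C) there exist an identity $l=r$ in $\Sigma'$, a substitution $\sigma$ (assigning terms over $\bigcup_{i\in I}A_i$ to variables) and a position $p$ of $\tau$ such that the subterm of $\tau$ at position $p$ is $\sigma(l)$, and $\tau'$ is obtained from $\tau$ by replacing that subterm by $\sigma(r)$; (C1) for some position $p$ of $\tau$, the subterm of $\tau$ at $p$ is $o(a_1,\dots,a_n)$, where $o$ is an $n$-ary operation symbol from $\mathfrak{F}$ and $a_1,\dots,a_n$ are elements of one and the same algebra $A_i$, and $\tau'$ is obtained from $\tau$ by replacing this subterm by the value of $o(a_1,\dots,a_n)$ in $A_i$. The algebra $A$ is isomorphic to the quotient of the algebra of terms over $\bigcup_{i\in I}A_i$ by the smallest equivalence relation containing $\rightsquigarrow$; a term represents an element $\alpha\in A$ if its class corresponds to $\alpha$. A normal form of $\alpha$ is a term $\tau$ over $\bigcup_{i\in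 I}A_i$ representing $\alpha$ for which there is no term $\tau'$ over the same set with $\tau\rightsquigarrow\tau'$.
   Formalization: In (C), the symbols 0 and 1 in a left side l may also match the elements of the A_i that they denote; read literally, t(0,a,b) with a in A_i\B, b in A_j\B, i≠j, rewrites to both b and the irreducible t(0_B,a,b), so normal forms would not be unique. *)

(* Defs.v *)
From Stdlib Require List.
From Stdlib Require Import Relations.
From mathcomp Require Import all_boot.
From mathcomp Require Import boolp classical_sets.

Set Implicit Arguments.
Unset Strict Implicit.
Unset Printing Implicit Defensive.

Local Open Scope classical_set_scope.

Record ternary_ring (T : Type) := TernaryRing {
  tr_t : T -> T -> T -> T;
  tr_q : T -> T -> T -> T;
  tr_0 : T;
  tr_1 : T;
  tr_t0l : forall x y, tr_t tr_0 x y = y;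
  tr_t0r : forall x y, tr_t x tr_0 y = y;
  tr_t1l : forall x, tr_t tr_1 x tr_0 = x;
  tr_t1r : forall x, tr_t x tr_1 tr_0 = x;
  tr_qt : forall x y z, tr_q x y (tr_t x y z) = z;
  tr_tq : forall x y z, tr_t x y (tr_q x y z) = z
}.

Definition is_hom (T T' : Type) (S : ternary_ring T) (S' : ternary_ring T')
    (f : T -> T') : Prop :=
  [/\ forall x y z, f (tr_t S x y z) = tr_t S' (f x) (f y) (f z),
      forall x y z, f (tr_q S x y z) = tr_q S' (f x) (f y) (f z),
      f (tr_0 S) = tr_0 S'
    & f (tr_1 S) = tr_1 S'].

Definition incl (U : Type) (X Y : set U) (h : X `<=` Y) (x : X) : Y :=
  SigSub (mem_set (h _ (set_mem (valP x)))).

(* As the index set is nonempty in the intended use, the leg from [B] of a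
   cocone over the inclusions of [B] in the [A i] is determined by the legs
   from the [A i]. *)
Definition is_cocone (I U : Type) (A : I -> set U) (B : set U)
    (SA : forall i, ternary_ring (A i)) (BA : forall i, B `<=` A i)
    (C : Type) (SC : ternary_ring C) (iota : forall i, A i -> C) : Prop :=
  (forall i, is_hom (SA i) SC (iota i)) /\
  (forall i j (b : B), iota i (incl (BA i) b) = iota j (incl (BA j) b)).

Definition is_amalgamated_free_product (I U : Type) (A : I -> set U)
    (B : set U) (SA : forall i, ternary_ring (A i)) (BA : forall i, B `<=` A i)
    (C : Type) (SC : ternary_ring C) (iota : forall i, A i -> C) : Prop :=
  is_cocone SA BA SC iota /\
  forall (D : Type) (SD : ternary_ring D) (kappa : forall i, A i -> D),
    is_cocone SA BA SD kappa ->
    exists f : C -> D,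
      [/\ is_hom SC SD f,
          forall i a, f (iota i a) = kappa i a
        & forall g : C -> D, is_hom SC SD g ->
            (forall i a, g (iota i a) = kappa i a) -> g =1 f].

(* Leaves are kept apart from the operation symbols by the constructors, so a
   carrier is automatically disjoint from the signature. *)
Inductive term (V : Type) : Type :=
| Leaf of V
| Tt of term V & term V & term V
| Tq of term V & term V & term V
| T0
| T1.
Arguments T0 {V}.
Arguments T1 {V}.

Fixpoint subst (V W : Type) (s : V -> term W) (p : term V) : term W :=
  match p with
  | Leaf v => s v
  | Tt p1 p2 p3 => Tt (subst s p1) (subst s p2) (subst s p3)
  | Tq p1 p2 p3 => Tq (subst s p1) (subst s p2) (subst s p3)
  | T0 => T0
  | T1 => T1
  end.

(* Identities are terms over the countable set [nat] of variables. *)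
Definition Sigma' : list (term nat * term nat) :=
  let x := Leaf 0 in let y := Leaf 1 in let z := Leaf 2 in
  [:: (Tt T0 x y, y);
      (Tt x T0 y, y);
      (Tt T1 x T0, x);
      (Tt x T1 T0, x);
      (Tq x y (Tt x y z), z);
      (Tt x y (Tq x y z), z);
      (Tq T0 x y, y);
      (Tq x T0 y, y);
      (Tq T1 x x, T0);
      (Tq x T1 x, T0)].

Section Rewriting.
Variables (I U : Type) (A : I -> set U) (SA : forall i, ternary_ring (A i)).

Definition uterm : Type := term (\bigcup_i A i).

Definition elt (i : I) (a : A i) : uterm :=
  Leaf (incl (@bigcup_sup U I i setT A Logic.I) a).

(* [instance s p u]: u is the instance s(p) of the pattern p, where each
   nullary symbol of p may be read as the symbol itself or as its value in an
   [A i].  The second reading cannot be dropped: for a in A_i \ B and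
   b in A_j \ B with i <> j, the term t(0,a,b) rewrites both to b and, by
   evaluating the symbol 0, to t(0_B,a,b), and under purely syntactic matching
   both of these would be irreducible. *)
Inductive instance (s : nat -> uterm) : term nat -> uterm -> Prop :=
| inst_var x : instance s (Leaf x) (s x)
| inst_t p1 p2 p3 u1 u2 u3 :
    instance s p1 u1 -> instance s p2 u2 -> instance s p3 u3 ->
    instance s (Tt p1 p2 p3) (Tt u1 u2 u3)
| inst_q p1 p2 p3 u1 u2 u3 :
    instance s p1 u1 -> instance s p2 u2 -> instance s p3 u3 ->
    instance s (Tq p1 p2 p3) (Tq u1 u2 u3)
| inst_0 : instance s T0 T0
| inst_1 : instance s T1 T1
| inst_0_value i : instance s T0 (elt (tr_0 (SA i)))
| inst_1_value i : instance s T1 (elt (tr_1 (SA i))).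

Inductive root_rewrites : uterm -> uterm -> Prop :=
| root_C l r s u :
    List.In (l, r) Sigma' -> instance s l u -> root_rewrites u (subst s r)
| root_C1_t i (a b c : A i) :
    root_rewrites (Tt (elt a) (elt b) (elt c)) (elt (tr_t (SA i) a b c))
| root_C1_q i (a b c : A i) :
    root_rewrites (Tq (elt a) (elt b) (elt c)) (elt (tr_q (SA i) a b c))
| root_C1_0 i : root_rewrites T0 (elt (tr_0 (SA i)))
| root_C1_1 i : root_rewrites T1 (elt (tr_1 (SA i))).

Inductive rewrites : uterm -> uterm -> Prop :=
| rw_root u v : root_rewrites u v -> rewrites u v
| rw_t1 u v x y : rewrites u v -> rewrites (Tt u x y) (Tt v x y)
| rw_t2 u v x y : rewrites u v -> rewrites (Tt x u y) (Tt x v y)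
| rw_t3 u v x y : rewrites u v -> rewrites (Tt x y u) (Tt x y v)
| rw_q1 u v x y : rewrites u v -> rewrites (Tq u x y) (Tq v x y)
| rw_q2 u v x y : rewrites u v -> rewrites (Tq x u y) (Tq x v y)
| rw_q3 u v x y : rewrites u v -> rewrites (Tq x y u) (Tq x y v).

Definition term_equiv : uterm -> uterm -> Prop :=
  clos_refl_sym_trans uterm rewrites.

Definition irreducible_term (u : uterm) : Prop := ~ exists v, rewrites u v.

(* [phi] induces an isomorphism from the quotient of the term algebra by
   [term_equiv] onto [C], sending the class of each a in [A i] to [iota i a]. *)
Definition is_quotient_iso (C : Type) (SC : ternary_ring C)
    (iota : forall i, A i -> C) (phi : uterm -> C) : Prop :=
  [/\ forall u v w, phi (Tt u v w) = tr_t SC (phi u) (phi v) (phi w),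
      forall u v w, phi (Tq u v w) = tr_q SC (phi u) (phi v) (phi w),
      phi T0 = tr_0 SC
    & phi T1 = tr_1 SC] /\
  [/\ forall i (a : A i), phi (elt a) = iota i a,
      forall u v, phi u = phi v <-> term_equiv u v
    & forall alpha, exists u, phi u = alpha].

Definition represents (C : Type) (SC : ternary_ring C)
    (iota : forall i, A i -> C) (u : uterm) (alpha : C) : Prop :=
  exists phi, is_quotient_iso SC iota phi /\ phi u = alpha.

Definition is_normal_form (C : Type) (SC : ternary_ring C)
    (iota : forall i, A i -> C) (alpha : C) (u : uterm) : Prop :=
  represents SC iota u alpha /\ irreducible_term u.

End Rewriting.

(* Main.v *)
(** The irreducible terms themselves carry a ternary ring structure, so that
    neither termination nor confluence of the rewriting relation is needed.
    One relation [graph a b c d] describes the graphs of both operations on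
    irreducible terms, t(a,b,c) = d and q(a,b,d) = c; it holds if this is true
    in some A_i, if a or b is 0 and c = d, if a = 1, c = 0 and d = b, if b = 1,
    c = 0 and d = a, if d is the term t(a,b,c), or if c is the term q(a,b,d).
    Given a and b, this is the graph of a bijection c |-> d, which gives the
    laws of ternary rings.  The resulting ring receives the A_i compatibly, and
    it is isomorphic to the free product by the universal property. *)
Require Import Defs.
From Stdlib Require Import Relations.
From mathcomp Require Import all_boot.
From mathcomp Require Import boolp classical_sets.

Local Open Scope classical_set_scope.

(** * The four identities that [Sigma'] adds to the axioms, the trivial ring, and homomorphisms *)

Lemma tr_q0l (T : Type) (S : ternary_ring T) x y : tr_q S (tr_0 S) x y = y.
Proof. by rewrite -{1}(tr_t0l S x y) tr_qt. Qed.

Lemma tr_q0r (T : Type) (S : ternary_ring T) x y : tr_q S x (tr_0 S) y = y.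
Proof. by rewrite -{1}(tr_t0r S x y) tr_qt. Qed.

Lemma tr_q1l (T : Type) (S : ternary_ring T) x : tr_q S (tr_1 S) x x = tr_0 S.
Proof. by rewrite -{2}(tr_t1l S x) tr_qt. Qed.

Lemma tr_q1r (T : Type) (S : ternary_ring T) x : tr_q S x (tr_1 S) x = tr_0 S.
Proof. by rewrite -{2}(tr_t1r S x) tr_qt. Qed.

Lemma tr_triv (T : Type) (S : ternary_ring T) x :
  tr_0 S = tr_1 S -> x = tr_0 S.
Proof. by move=> S01; rewrite -[LHS](tr_t1l S) -S01 tr_t0l. Qed.

Section Amalgam.
Set Implicit Arguments.
Unset Strict Implicit.

Lemma is_hom_id (T : Type) (S : ternary_ring T) : is_hom S S id.
Proof. by split. Qed.

Lemma is_hom_comp (T T' T'' : Type) (S : ternary_ring T)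
    (S' : ternary_ring T') (S'' : ternary_ring T'') (f : T -> T')
    (g : T' -> T'') : is_hom S S' f -> is_hom S' S'' g -> is_hom S S'' (g \o f).
Proof.
by move=> [ft fq f0 f1] [gt gq g0 g1]; split=> [x y z|x y z||] /=;
   rewrite ?ft ?fq ?f0 ?f1.
Qed.

Variables (I U : Type) (A : I -> set U) (B : set U).
Variables (SA : forall i, ternary_ring (A i)) (SB : ternary_ring B) (i0 : I).
Hypothesis BA : forall i, B `<=` A i.
Hypothesis B_subalgebra : forall i, is_hom SB (SA i) (incl (BA i)).
Hypothesis A_meet : forall i j, i <> j -> A i `&` A j = B.

Local Notation irr := (irreducible_term SA).
Local Notation rw := (rewrites SA).
Local Notation equiv := (term_equiv SA).

(** * Leaves over the union of the [A i] *)

Lemma elt_inj i (a b : A i) : elt a = elt b -> a = b.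
Proof. by case=> /val_inj. Qed.

Lemma elt_incl i j (b : B) : elt (incl (BA i) b) = elt (incl (BA j) b).
Proof. by congr Leaf; apply: val_inj. Qed.

(** Equal leaves have the same underlying element of [U], which lies in both carriers and hence in
    [B] by [A_meet]. *)
Lemma elt_meet i j (a : A i) (a' : A j) : i <> j -> elt a = elt a' ->
  exists b : B, a = incl (BA i) b /\ a' = incl (BA j) b.
Proof.
move=> ij [aa'].
have Ba : B (val a).
  rewrite -(A_meet ij); split; first exact: set_mem (valP a).
  by rewrite (aa' : val a = val a'); exact: set_mem (valP a').
by exists (SigSub (mem_set Ba)); split; apply: val_inj.
Qed.

Lemma Leaf_elt (v : \bigcup_i A i) : exists i (a : A i), Leaf v = elt a.
Proof.
have [i _ Aiv] := set_mem (valP v).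
by exists i, (SigSub (mem_set Aiv)); congr Leaf; apply: val_inj.
Qed.

(** The constants of all [A i] are those of [B], so the leaves [zero] and [one] do not depend on the
    index [i0]; [elt_0] and [elt_1] record this. *)
Let zero : uterm A := elt (tr_0 (SA i0)).
Let one : uterm A := elt (tr_1 (SA i0)).

Lemma elt_0 i : elt (tr_0 (SA i)) = zero.
Proof.
have [_ _ <- _] := B_subalgebra i; have [_ _ b0 _] := B_subalgebra i0.
by rewrite /zero -b0; exact: elt_incl.
Qed.

Lemma elt_1 i : elt (tr_1 (SA i)) = one.
Proof.
have [_ _ _ <-] := B_subalgebra i; have [_ _ _ b1] := B_subalgebra i0.
by rewrite /one -b1; exact: elt_incl.
Qed.

(** * The partial operations on the union of the [A i] *)

Definition value (a b c d : uterm A) : Prop :=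
  exists i (x y w : A i),
    [/\ a = elt x, b = elt y, c = elt w & d = elt (tr_t (SA i) x y w)].

Definition same_algebra (a b c : uterm A) : Prop :=
  exists i (x y w : A i), [/\ a = elt x, b = elt y & c = elt w].

Lemma value_same_algebra a b c d : value a b c d ->
  same_algebra a b c /\ same_algebra a b d.
Proof.
move=> [i [x [y [w [-> -> -> ->]]]]].
by split; exists i, x, y; [exists w | exists (tr_t (SA i) x y w)].
Qed.

(** Arguments that lie in two different algebras lie in [B], and both algebras restrict to the
    operation of [B] there. *)
Lemma value_fun a b c d d' : value a b c d -> value a b c d' -> d = d'.
Proof.
move=> [i [x [y [w [ax bxy cw ->]]]]] [j [x' [y' [w' [ax' bxy' cw' ->]]]]].
have [ij|ij] := pselect (i = j).
  subst j; congr elt; congr (tr_t _ _ _ _); apply: elt_inj; congruence.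
have [p [-> ->]] : exists p, x = incl (BA i) p /\ x' = incl (BA j) p.
  by apply: elt_meet; rewrite // -ax.
have [q [-> ->]] : exists p, y = incl (BA i) p /\ y' = incl (BA j) p.
  by apply: elt_meet; rewrite // -bxy.
have [r [-> ->]] : exists p, w = incl (BA i) p /\ w' = incl (BA j) p.
  by apply: elt_meet; rewrite // -cw.
by have [<- _ _ _] := B_subalgebra i; have [<- _ _ _] := B_subalgebra j;
   exact: elt_incl.
Qed.

Lemma value_inj a b c c' d : value a b c d -> value a b c' d -> c = c'.
Proof.
move=> [i [x [y [w [ax bxy -> dw]]]]] [j [x' [y' [w' [ax' bxy' -> dw']]]]].
(* Writing each third argument as q of the result turns the claim into single-valuedness of q on the
   union. *)
rewrite -(tr_qt (SA i) x y w) -(tr_qt (SA j) x' y' w').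
move: dw dw'; set v := tr_t _ _ _ _; set v' := tr_t _ _ _ _ => dw dw'.
have [ij|ij] := pselect (i = j).
  subst j; congr elt; congr (tr_q _ _ _ _); apply: elt_inj; congruence.
have [p [-> ->]] : exists p, x = incl (BA i) p /\ x' = incl (BA j) p.
  by apply: elt_meet; rewrite // -ax.
have [q [-> ->]] : exists p, y = incl (BA i) p /\ y' = incl (BA j) p.
  by apply: elt_meet; rewrite // -bxy.
have [r [-> ->]] : exists p, v = incl (BA i) p /\ v' = incl (BA j) p.
  by apply: elt_meet; rewrite // -dw.
by have [_ <- _ _] := B_subalgebra i; have [_ <- _ _] := B_subalgebra j;
   exact: elt_incl.
Qed.

Lemma value_0 a b c d : value a b c d -> a = zero \/ b = zero -> c = d.
Proof.
move=> [i [x [y [w [-> -> -> ->]]]]]; rewrite -(elt_0 i).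
by case=> /elt_inj->; rewrite ?tr_t0l ?tr_t0r.
Qed.

Lemma value_1l a b c d : value a b c d -> a = one -> c = zero <-> d = b.
Proof.
move=> [i [x [y [w [-> -> -> ->]]]]]; rewrite -(elt_1 i) -(elt_0 i).
move=> /elt_inj->; split=> /elt_inj; first by move->; rewrite tr_t1l.
(* Here [w] equals q(1,y,t(1,y,w)) = q(1,y,y) = 0. *)
by move=> e; rewrite -(tr_qt (SA i) (tr_1 (SA i)) y w) e tr_q1l.
Qed.

Lemma value_1r a b c d : value a b c d -> b = one -> c = zero <-> d = a.
Proof.
move=> [i [x [y [w [-> -> -> ->]]]]]; rewrite -(elt_1 i) -(elt_0 i).
move=> /elt_inj->; split=> /elt_inj; first by move->; rewrite tr_t1r.
by move=> e; rewrite -(tr_qt (SA i) x (tr_1 (SA i)) w) e tr_q1r.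
Qed.

(** * Root redexes and the recursive description of irreducible terms *)

(** The ways in which a root step can apply to [Tt a b c] with irreducible arguments: evaluation in
    one algebra, or a left-hand side of [Sigma']. The constants occur only as leaves, since [T0] and
    [T1] are themselves reducible. *)
Definition reducible_t (a b c : uterm A) : Prop :=
  [\/ same_algebra a b c, a = zero \/ b = zero,
      (a = one \/ b = one) /\ c = zero | exists d, c = Tq a b d].

Definition reducible_q (a b d : uterm A) : Prop :=
  [\/ same_algebra a b d, a = zero \/ b = zero,
      (a = one /\ d = b) \/ (b = one /\ d = a) | exists c, d = Tt a b c].

Lemma irr_Leaf v : irr (Leaf v).
Proof.
case=> w h; inversion h as [? ? h'| | | | | |].
inversion h' as [l r s ? hin hi| | | |]; subst.
by repeat (case: hin => [[? ?]|hin]; [subst; inversion hi|]).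
Qed.

Lemma irr_N0 : ~ irr T0.
Proof. by apply; exists (elt (tr_0 (SA i0))); apply: rw_root; constructor. Qed.

Lemma irr_N1 : ~ irr T1.
Proof. by apply; exists (elt (tr_1 (SA i0))); apply: rw_root; constructor. Qed.

Lemma instance_0 s u : irr u -> instance SA s T0 u -> u = zero.
Proof. by move=> hu h; inversion h; subst; [case: irr_N0 | exact: elt_0]. Qed.

Lemma instance_1 s u : irr u -> instance SA s T1 u -> u = one.
Proof. by move=> hu h; inversion h; subst; [case: irr_N1 | exact: elt_1]. Qed.


Let env (a b c : uterm A) (n : nat) : uterm A :=
  match n with 0 => a | 1 => b | _ => c end.

Local Ltac root_step l r s :=
  apply: rw_root; apply: (@root_C _ _ _ SA l r s) => /=;
    [tauto | repeat constructor].

Lemma rw_t0l b c : rw (Tt zero b c) c.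
Proof. by root_step (Tt T0 (Leaf 0) (Leaf 1)) (Leaf 1) (env b c c). Qed.

Lemma rw_t0r b c : rw (Tt b zero c) c.
Proof. by root_step (Tt (Leaf 0) T0 (Leaf 1)) (Leaf 1) (env b c c). Qed.

Lemma rw_t1l a : rw (Tt one a zero) a.
Proof. by root_step (Tt T1 (Leaf 0) T0) (Leaf 0) (env a a a). Qed.

Lemma rw_t1r a : rw (Tt a one zero) a.
Proof. by root_step (Tt (Leaf 0) T1 T0) (Leaf 0) (env a a a). Qed.

Lemma rw_qt a b c : rw (Tq a b (Tt a b c)) c.
Proof.
by root_step (Tq (Leaf 0) (Leaf 1) (Tt (Leaf 0) (Leaf 1) (Leaf 2))) (Leaf 2)
  (env a b c).
Qed.

Lemma rw_tq a b c : rw (Tt a b (Tq a b c)) c.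
Proof.
by root_step (Tt (Leaf 0) (Leaf 1) (Tq (Leaf 0) (Leaf 1) (Leaf 2))) (Leaf 2)
  (env a b c).
Qed.

Lemma rw_q0l b c : rw (Tq zero b c) c.
Proof. by root_step (Tq T0 (Leaf 0) (Leaf 1)) (Leaf 1) (env b c c). Qed.

Lemma rw_q0r b c : rw (Tq b zero c) c.
Proof. by root_step (Tq (Leaf 0) T0 (Leaf 1)) (Leaf 1) (env b c c). Qed.

Lemma rw_q1l a : rw (Tq one a a) T0.
Proof. by root_step (Tq T1 (Leaf 0) (Leaf 0)) (@T0 nat) (env a a a). Qed.

Lemma rw_q1r a : rw (Tq a one a) T0.
Proof. by root_step (Tq (Leaf 0) T1 (Leaf 0)) (@T0 nat) (env a a a). Qed.

Lemma reducible_t_rw a b c : reducible_t a b c -> exists v, rw (Tt a b c) v.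
Proof.
case=> [[i [x [y [w [-> -> ->]]]]]|[]->|[[]-> ->]|[d ->]].
- by exists (elt (tr_t (SA i) x y w)); apply: rw_root; constructor.
- by exists c; exact: rw_t0l.
- by exists c; exact: rw_t0r.
- by exists b; exact: rw_t1l.
- by exists a; exact: rw_t1r.
- by exists d; exact: rw_tq.
Qed.

Lemma reducible_q_rw a b d : reducible_q a b d -> exists v, rw (Tq a b d) v.
Proof.
case=> [[i [x [y [w [-> -> ->]]]]]|[]->|[[-> ->]|[-> ->]]|[c ->]].
- by exists (elt (tr_q (SA i) x y w)); apply: rw_root; constructor.
- by exists d; exact: rw_q0l.
- by exists d; exact: rw_q0r.
- by exists T0; exact: rw_q1l.
- by exists T0; exact: rw_q1r.
- by exists c; exact: rw_qt.
Qed.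

(** Inversion runs through the ten identities: those headed by q cannot match, and each of the
    others yields a clause of [reducible_t]. *)
Lemma root_reducible_t a b c v : irr a -> irr b -> irr c ->
  root_rewrites SA (Tt a b c) v -> reducible_t a b c.
Proof.
move=> ha hb hc h; inversion h as [l r s u hin hi|i x y w| | |]; subst.
  by repeat (case: hin => [[? ?]|hin]; [subst; inversion hi; subst|]) => //;
    repeat match goal with
    | H : instance _ _ T0 ?u, K : irreducible_term _ ?u |- _ =>
        move: (instance_0 K H) => ?; clear H
    | H : instance _ _ T1 ?u, K : irreducible_term _ ?u |- _ =>
        move: (instance_1 K H) => ?; clear H
    | H : instance _ _ (Leaf _) _ |- _ => inversion H; subst; clear H
    | H : instance _ _ (Tq _ _ _) _ |- _ => inversion H; subst; clear H
    end;
    (apply: Or42; tauto) || (apply: Or43; tauto) || (apply: Or44; eexists).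
by apply: Or41; exists i, x, y, w.
Qed.

Lemma root_reducible_q a b d v : irr a -> irr b -> irr d ->
  root_rewrites SA (Tq a b d) v -> reducible_q a b d.
Proof.
move=> ha hb hd h; inversion h as [l r s u hin hi| |i x y w| |]; subst.
  by repeat (case: hin => [[? ?]|hin]; [subst; inversion hi; subst|]) => //;
    repeat match goal with
    | H : instance _ _ T0 ?u, K : irreducible_term _ ?u |- _ =>
        move: (instance_0 K H) => ?; clear H
    | H : instance _ _ T1 ?u, K : irreducible_term _ ?u |- _ =>
        move: (instance_1 K H) => ?; clear H
    | H : instance _ _ (Leaf _) _ |- _ => inversion H; subst; clear H
    | H : instance _ _ (Tt _ _ _) _ |- _ => inversion H; subst; clear H
    end;
    (apply: Or42; tauto) || (apply: Or43; tauto) || (apply: Or44; eexists).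
by apply: Or41; exists i, x, y, w.
Qed.

Lemma irr_TtP a b c :
  irr (Tt a b c) <-> [/\ irr a, irr b, irr c & ~ reducible_t a b c].
Proof.
split=> [h|[ha hb hc hr] [v h]].
  split=> [[v r]|[v r]|[v r]|/reducible_t_rw //]; apply: h.
  - by exists (Tt v b c); constructor.
  - by exists (Tt a v c); constructor.
  - by exists (Tt a b v); constructor.
inversion h as [? ? h'| ? w | ? w | ? w | | |]; subst.
- exact: hr (root_reducible_t ha hb hc h').
- by apply: ha; exists w.
- by apply: hb; exists w.
- by apply: hc; exists w.
Qed.

Lemma irr_TqP a b d :
  irr (Tq a b d) <-> [/\ irr a, irr b, irr d & ~ reducible_q a b d].
Proof.
split=> [h|[ha hb hd hr] [v h]].
  split=> [[v r]|[v r]|[v r]|/reducible_q_rw //]; apply: h.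
  - by exists (Tq v b d); constructor.
  - by exists (Tq a v d); constructor.
  - by exists (Tq a b v); constructor.
inversion h as [? ? h'| | | | ? w | ? w | ? w]; subst.
- exact: hr (root_reducible_q ha hb hd h').
- by apply: ha; exists w.
- by apply: hb; exists w.
- by apply: hd; exists w.
Qed.

(** When 0 = 1 every [A i] is trivial, so the only leaf is [zero]; a compound irreducible term would
    have first argument [zero] by induction and thus be reducible at the root. *)
Lemma irr_triv u : irr u -> zero = one -> u = zero.
Proof.
move=> + z1; elim: u => [v|a iha b _ c _|a iha b _ c _||].
- move=> _; have [i [x ->]] := Leaf_elt v.
  by rewrite (@tr_triv _ (SA i) x) ?elt_0 //; apply: elt_inj;
     rewrite elt_0 elt_1.
- by case/irr_TtP=> /iha a0 _ _ []; apply: Or42; left.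
- by case/irr_TqP=> /iha a0 _ _ []; apply: Or42; left.
- by move/irr_N0.
- by move/irr_N1.
Qed.

(** * The common graph of both operations on irreducible terms *)

Inductive graph (a b c d : uterm A) : Prop :=
| graph_value of value a b c d
| graph_0 of a = zero \/ b = zero & c = d
| graph_1l of a = one & c = zero & d = b
| graph_1r of b = one & c = zero & d = a
| graph_t of d = Tt a b c
| graph_q of c = Tq a b d.

(** No term is a proper subterm of itself. In [graph_inj_t] this excludes the clauses [graph_1l] and
    [graph_1r]. *)
Lemma Tt_neq (a b c : uterm A) : b <> Tt a b c /\ a <> Tt a b c.
Proof.
split; move: a b c.
  by move=> a b; elim: b a => // ? _ b IH ? _ a c [? /IH].
by elim=> // a IH ? _ ? _ b c [/IH].
Qed.


(** Every clause other than [graph_t] would exhibit a redex at the root of [Tt a b c]. *)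
Lemma graph_fun_t a b c d d' :
  d = Tt a b c -> irr d -> graph a b c d' -> d' = d.
Proof.
move=> -> /irr_TtP[_ _ _ nr] [v|ab0 _|a1 c0 _|b1 c0 _|//|cq]; case: nr.
- by apply: Or41; case: (value_same_algebra v).
- by apply: Or42.
- by apply: Or43; tauto.
- by apply: Or43; tauto.
- by apply: Or44; exists d'.
Qed.

Lemma graph_inj_q a b c c' d :
  c = Tq a b d -> irr c -> graph a b c' d -> c' = c.
Proof.
move=> -> /irr_TqP[_ _ _ nr] [v|ab0 _|a1 _ db|b1 _ da|dt|//]; case: nr.
- by apply: Or41; case: (value_same_algebra v).
- by apply: Or42.
- by apply: Or43; tauto.
- by apply: Or43; tauto.
- by apply: Or44; exists c'.
Qed.

(** A compound [c] is not a leaf, the clause [graph_0] would make [c] reducible, and [graph_t] would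
    make [d'] the redex t(a,b,q(a,b,d)). *)
Lemma graph_fun_q a b c d d' :
  c = Tq a b d -> irr c -> irr d' -> graph a b c d' -> d' = d.
Proof.
move=> -> hc hd' [[i [x [y [w [_ _ //]]]]]|ab0 _|_ //|_ //|dt|[->] //].
  by have /irr_TqP[_ _ _ []] := hc; apply: Or42.
by move: hd'; rewrite dt => /irr_TtP[_ _ _ []]; apply: Or44; exists d.
Qed.

Lemma graph_inj_t a b c c' d :
  d = Tt a b c -> irr d -> irr c' -> graph a b c' d -> c' = c.
Proof.
have [nb na] := Tt_neq a b c; move=> -> hd hc'.
case=> [[i [x [y [w [_ _ _ //]]]]]|ab0 _|_ _ /esym//|_ _ /esym//|[->] //|cq].
  by have /irr_TtP[_ _ _ []] := hd; apply: Or42.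
by move: hc'; rewrite cq => /irr_TqP[_ _ _ []]; apply: Or44; exists c.
Qed.

(** Overlapping clauses agree: compound terms are settled by the preceding lemmas, two values by
    [value_fun], and a value against a clause for 0 or 1 by the laws of its algebra. *)
Lemma graph_fun a b c d d' : irr c -> irr d -> irr d' ->
  graph a b c d -> graph a b c d' -> d = d'.
Proof.
move=> hc hd hd' g g'.
(* If 0 = 1, the clauses for a = 0 and a = 1 could apply together, but all irreducible terms then
   coincide. *)
have [z1|z1] := pselect (zero = one).
  by rewrite (irr_triv hd z1) (irr_triv hd' z1).
case: (g) => [v|z cd|a1 c0 db|b1 c0 da|dt|cq];
  case: (g') => [v'|z' cd'|a1' c0' db'|b1' c0' da'|dt'|cq'];
  (* Each of the 36 pairs of clauses is closed by the first alternative that works. *)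
  by [congruence
  | case: z; congruence
  | case: z'; congruence
  | exact/esym/(graph_fun_t dt hd g')
  | exact: graph_fun_t dt' hd' g
  | exact/esym/(graph_fun_q cq hc hd' g')
  | exact: graph_fun_q cq' hc hd g
  | exact: value_fun v v'
  | rewrite -(value_0 v)
  | rewrite -(value_0 v')
  | rewrite (proj1 (value_1l v _))
  | rewrite (proj1 (value_1l v' _))
  | rewrite (proj1 (value_1r v _))
  | rewrite (proj1 (value_1r v' _))].
Qed.

Lemma graph_inj a b c c' d : irr c -> irr c' -> irr d ->
  graph a b c d -> graph a b c' d -> c = c'.
Proof.
move=> hc hc' hd g g'.
have [z1|z1] := pselect (zero = one).
  by rewrite (irr_triv hc z1) (irr_triv hc' z1).
case: (g) => [v|z cd|a1 c0 db|b1 c0 da|dt|cq];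
  case: (g') => [v'|z' cd'|a1' c0' db'|b1' c0' da'|dt'|cq'];
  by [congruence
  | case: z; congruence
  | case: z'; congruence
  | exact/esym/(graph_inj_t dt hd hc' g')
  | exact: graph_inj_t dt' hd hc g
  | exact/esym/(graph_inj_q cq hc g')
  | exact: graph_inj_q cq' hc' g
  | exact: value_inj v v'
  | rewrite (value_0 v)
  | rewrite (value_0 v')
  | rewrite (proj2 (value_1l v _))
  | rewrite (proj2 (value_1l v' _))
  | rewrite (proj2 (value_1r v _))
  | rewrite (proj2 (value_1r v' _))].
Qed.

(** A root redex supplies the result through its clause; without one, [Tt a b c] is itself
    irreducible and serves as the result. *)
Lemma graph_total_t a b c : irr a -> irr b -> irr c ->
  exists d, irr d /\ graph a b c d.
Proof.
move=> ha hb hc; have [r|nr] := pselect (reducible_t a b c); last first.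
  by exists (Tt a b c); split; [exact/irr_TtP | exact: graph_t].
case: r => [[i [x [y [w [-> -> ->]]]]]|ab0|[[a1|b1] c0]|[d cq]].
- exists (elt (tr_t (SA i) x y w)); split; first exact: irr_Leaf.
  by apply: graph_value; exists i, x, y, w.
- by exists c; split=> //; exact: graph_0.
- by exists b; split=> //; exact: graph_1l.
- by exists a; split=> //; exact: graph_1r.
- exists d; split; last exact: graph_q.
  by move: hc; rewrite cq => /irr_TqP[].
Qed.

Lemma graph_total_q a b d : irr a -> irr b -> irr d ->
  exists c, irr c /\ graph a b c d.
Proof.
move=> ha hb hd; have [r|nr] := pselect (reducible_q a b d); last first.
  by exists (Tq a b d); split; [exact/irr_TqP | exact: graph_q].
case: r => [[i [x [y [w [-> -> ->]]]]]|ab0|[[a1 db]|[b1 da]]|[c dt]].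
- exists (elt (tr_q (SA i) x y w)); split; first exact: irr_Leaf.
  by apply: graph_value; exists i, x, y, (tr_q (SA i) x y w); rewrite tr_tq.
- by exists d; split=> //; exact: graph_0.
- by exists zero; split; [exact: irr_Leaf | exact: graph_1l].
- by exists zero; split; [exact: irr_Leaf | exact: graph_1r].
- exists c; split; last exact: graph_t.
  by move: hd; rewrite dt => /irr_TtP[].
Qed.

(** * Compatibility of the graph with the equivalence generated by rewriting *)

Lemma equiv_step u v : rw u v -> equiv u v.
Proof. exact: rst_step. Qed.

Lemma equiv_context f u v : (forall x y, rw x y -> rw (f x) (f y)) ->
  equiv u v -> equiv (f u) (f v).
Proof.
move=> rwf; elim=> [x y /rwf /equiv_step //|x|x y _|x y w _ + _].
- exact: rst_refl.
- exact: rst_sym.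
- exact: rst_trans.
Qed.

Lemma equiv_t a b c a' b' c' :
  equiv a a' -> equiv b b' -> equiv c c' -> equiv (Tt a b c) (Tt a' b' c').
Proof.
move=> aa' bb' cc'.
apply: (rst_trans _ _ _ (Tt a' b c)).
  by apply: (equiv_context (f := fun u => Tt u b c)) => // x y; exact: rw_t1.
apply: (rst_trans _ _ _ (Tt a' b' c)).
  by apply: (equiv_context (f := fun u => Tt a' u c)) => // x y; exact: rw_t2.
by apply: (equiv_context (f := fun u => Tt a' b' u)) => // x y; exact: rw_t3.
Qed.

Lemma equiv_q a b c a' b' c' :
  equiv a a' -> equiv b b' -> equiv c c' -> equiv (Tq a b c) (Tq a' b' c').
Proof.
move=> aa' bb' cc'.
apply: (rst_trans _ _ _ (Tq a' b c)).
  by apply: (equiv_context (f := fun u => Tq u b c)) => // x y; exact: rw_q1.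
apply: (rst_trans _ _ _ (Tq a' b' c)).
  by apply: (equiv_context (f := fun u => Tq a' u c)) => // x y; exact: rw_q2.
by apply: (equiv_context (f := fun u => Tq a' b' u)) => // x y; exact: rw_q3.
Qed.

Lemma graph_equiv_t a b c d : graph a b c d -> equiv (Tt a b c) d.
Proof.
case=> [[i [x [y [w [-> -> -> ->]]]]]|[]-> -> |-> -> -> |-> -> -> |-> |-> ].
- by apply/equiv_step/rw_root; constructor.
- exact/equiv_step/rw_t0l.
- exact/equiv_step/rw_t0r.
- exact/equiv_step/rw_t1l.
- exact/equiv_step/rw_t1r.
- exact: rst_refl.
- exact/equiv_step/rw_tq.
Qed.

(** Replacing [d] by the equivalent [Tt a b c] produces the redex q(a,b,t(a,b,c)). *)
Lemma graph_equiv_q a b c d : graph a b c d -> equiv (Tq a b d) c.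
Proof.
move/graph_equiv_t=> g; apply: (rst_trans _ _ _ (Tq a b (Tt a b c))).
  by apply: equiv_q; [exact: rst_refl | exact: rst_refl | exact: rst_sym].
exact/equiv_step/rw_qt.
Qed.

(** * The ternary ring of irreducible terms *)

Local Notation nf := {u : uterm A | irr u}.

Lemma nf_inj (a b : nf) : sval a = sval b -> a = b.
Proof.
by case: a b => [u hu] [v hv] /= uv; subst v; congr exist;
   exact: Prop_irrelevance.
Qed.

Lemma nf_total_t (a b c : nf) :
  exists d : nf, graph (sval a) (sval b) (sval c) (sval d).
Proof.
case: a b c => [a ha] [b hb] [c hc] /=.
by have [d [hd g]] := graph_total_t ha hb hc; exists (exist _ d hd).
Qed.

Lemma nf_total_q (a b d : nf) :
  exists c : nf, graph (sval a) (sval b) (sval c) (sval d).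
Proof.
case: a b d => [a ha] [b hb] [d hd] /=.
by have [c [hc g]] := graph_total_q ha hb hd; exists (exist _ c hc).
Qed.

(** Choice picks a result from [nf_total_t]; it is the only one by [graph_fun], so [nf_tP] and
    [nf_t_eq] determine [nf_t]. *)
Definition nf_t (a b c : nf) : nf := sval (cid (nf_total_t a b c)).

Definition nf_q (a b d : nf) : nf := sval (cid (nf_total_q a b d)).

Lemma nf_tP (a b c : nf) :
  graph (sval a) (sval b) (sval c) (sval (nf_t a b c)).
Proof. by rewrite /nf_t; case: cid. Qed.

Lemma nf_qP (a b d : nf) :
  graph (sval a) (sval b) (sval (nf_q a b d)) (sval d).
Proof. by rewrite /nf_q; case: cid. Qed.

Lemma nf_t_eq (a b c d : nf) :
  graph (sval a) (sval b) (sval c) (sval d) -> nf_t a b c = d.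
Proof.
move=> g; apply: nf_inj.
by apply: graph_fun (nf_tP a b c) g; exact: svalP.
Qed.

Lemma nf_q_eq (a b c d : nf) :
  graph (sval a) (sval b) (sval c) (sval d) -> nf_q a b d = c.
Proof.
move=> g; apply: nf_inj.
by apply: graph_inj (nf_qP a b d) g; exact: svalP.
Qed.

Definition nf_elt i (a : A i) : nf :=
  exist (fun u => irr u) (elt a) (@irr_Leaf _).

Lemma nf_t0l b c : nf_t (nf_elt (tr_0 (SA i0))) b c = c.
Proof. by apply: nf_t_eq; apply: graph_0 => //; left. Qed.

Lemma nf_t0r a c : nf_t a (nf_elt (tr_0 (SA i0))) c = c.
Proof. by apply: nf_t_eq; apply: graph_0 => //; right. Qed.

Lemma nf_t1l b :
  nf_t (nf_elt (tr_1 (SA i0))) b (nf_elt (tr_0 (SA i0))) = b.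
Proof. by apply: nf_t_eq; exact: graph_1l. Qed.

Lemma nf_t1r a :
  nf_t a (nf_elt (tr_1 (SA i0))) (nf_elt (tr_0 (SA i0))) = a.
Proof. by apply: nf_t_eq; exact: graph_1r. Qed.

Lemma nf_qt a b c : nf_q a b (nf_t a b c) = c.
Proof. by apply: nf_q_eq; exact: nf_tP. Qed.

Lemma nf_tq a b c : nf_t a b (nf_q a b c) = c.
Proof. by apply: nf_t_eq; exact: nf_qP. Qed.

Definition nf_ring : ternary_ring nf :=
  TernaryRing nf_t0l nf_t0r nf_t1l nf_t1r nf_qt nf_tq.

Lemma nf_cocone : is_cocone SA BA nf_ring nf_elt.
Proof.
split=> [i|i j b]; last by apply: nf_inj; exact: elt_incl.
split=> [x y w|x y w||] /=.
- by apply/esym/nf_t_eq/graph_value; exists i, x, y, w.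
(* Since [value] is phrased with t, the witness for the third argument is q(x,y,w), and [tr_tq]
   recovers [w] as the result. *)
- apply/esym/nf_q_eq/graph_value; exists i, x, y, (tr_q (SA i) x y w).
  by rewrite tr_tq.
- by apply: nf_inj; exact: elt_0.
- by apply: nf_inj; exact: elt_1.
Qed.

(** * Evaluation of terms along a cocone *)

(** The homomorphisms from the term algebra that extend the legs [kappa]. The conjuncts follow the
    shape of [is_quotient_iso], so that its maps qualify directly. *)
Definition evaluates (D : Type) (SD : ternary_ring D)
    (kappa : forall i, A i -> D) (phi : uterm A -> D) : Prop :=
  [/\ forall u v w, phi (Tt u v w) = tr_t SD (phi u) (phi v) (phi w),
      forall u v w, phi (Tq u v w) = tr_q SD (phi u) (phi v) (phi w),
      phi T0 = tr_0 SD
    & phi T1 = tr_1 SD] /\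
  forall i (a : A i), phi (elt a) = kappa i a.

Fixpoint eval (D : Type) (SD : ternary_ring D) (f : \bigcup_i A i -> D)
    (u : uterm A) : D :=
  match u with
  | Leaf v => f v
  | Tt a b c => tr_t SD (eval SD f a) (eval SD f b) (eval SD f c)
  | Tq a b c => tr_q SD (eval SD f a) (eval SD f b) (eval SD f c)
  | T0 => tr_0 SD
  | T1 => tr_1 SD
  end.

Lemma evaluates_exists (D : Type) (SD : ternary_ring D) kappa :
  is_cocone SA BA SD kappa -> exists phi, evaluates SD kappa phi.
Proof.
move=> [_ kB].
(* A leaf that belongs to several [A i] comes from [B], where the legs agree, so its value does not
   depend on the algebra chosen. *)
have /choice[f fP] : forall v, exists d : D,
    forall i (a : A i), Leaf v = elt a -> d = kappa i a.
  move=> v; have [i [a va]] := Leaf_elt v; exists (kappa i a) => j b.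
  rewrite va => ab; have [ij|ij] := pselect (i = j).
    by subst j; rewrite (elt_inj ab).
  by have [p [-> ->]] := elt_meet ij ab.
by exists (eval SD f); split=> // i a; exact: fP.
Qed.

Lemma evaluates_unique (D : Type) (SD : ternary_ring D) kappa phi psi :
  evaluates SD kappa phi -> evaluates SD kappa psi -> phi =1 psi.
Proof.
move=> [[phit phiq phi0 phi1] phiE] [[psit psiq psi0 psi1] psiE].
elim=> [v|a iha b ihb c ihc|a iha b ihb c ihc||].
- by have [i [a ->]] := Leaf_elt v; rewrite phiE psiE.
- by rewrite phit psit iha ihb ihc.
- by rewrite phiq psiq iha ihb ihc.
- by rewrite phi0.
- by rewrite phi1.
Qed.

Lemma evaluates_hom (D D' : Type) (SD : ternary_ring D)
    (SD' : ternary_ring D') (kappa : forall i, A i -> D)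
    (kappa' : forall i, A i -> D') f phi :
  is_hom SD SD' f -> (forall i a, f (kappa i a) = kappa' i a) ->
  evaluates SD kappa phi -> evaluates SD' kappa' (f \o phi).
Proof.
move=> [ft fq f0 f1] fk [[phit phiq phi0 phi1] phiE].
by split=> [|i a]; [split=> [u v w|u v w||] |] => /=;
   rewrite ?phit ?phiq ?phi0 ?phi1 ?phiE ?fk.
Qed.

(** All identities of [Sigma'] hold in every ternary ring, and evaluation inside an [A i] is
    respected because the legs are homomorphisms. *)
Lemma evaluates_equiv (D : Type) (SD : ternary_ring D) kappa phi u v :
  is_cocone SA BA SD kappa -> evaluates SD kappa phi ->
  equiv u v -> phi u = phi v.
Proof.
move=> [kh _] [[phit phiq phi0 phi1] phiE].
(* A constant of the pattern read as its value in some [A i] evaluates to the constant of [SD], so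
   an instance evaluates like the plain substitution. *)
have inst s l w : instance SA s l w -> phi w = phi (subst s l).
  elim=> //= [? ? ? ? ? ? _ e1 _ e2 _ e3|? ? ? ? ? ? _ e1 _ e2 _ e3|i|i].
  - by rewrite !phit e1 e2 e3.
  - by rewrite !phiq e1 e2 e3.
  - by rewrite phiE phi0; have [_ _ ->] := kh i.
  - by rewrite phiE phi1; have [_ _ _ ->] := kh i.
elim=> [{}u {}v|//|? ? _ -> //|? ? ? _ -> _ -> //].
elim=> [{}u {}v|? ? ? ? _ e|? ? ? ? _ e|? ? ? ? _ e|? ? ? ? _ e|? ? ? ? _ e
       |? ? ? ? _ e]; rewrite ?phit ?phiq ?e //.
case=> [l r s w hin /inst->|i a b c|i a b c|i|i].
- by repeat (case: hin => [[<- <-]|hin]) => //=;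
    rewrite ?(phit, phiq, phi0, phi1) ?tr_t0l ?tr_t0r ?tr_t1l ?tr_t1r ?tr_qt
      ?tr_tq ?tr_q0l ?tr_q0r ?tr_q1l ?tr_q1r.
- by rewrite phit !phiE; have [->] := kh i.
- by rewrite phiq !phiE; have [_ ->] := kh i.
- by rewrite phi0 phiE; have [_ _ ->] := kh i.
- by rewrite phi1 phiE; have [_ _ _ ->] := kh i.
Qed.

(** This takes the place of termination: evaluation in [nf_ring] finds an equivalent irreducible
    term. *)
Lemma nf_equiv phi u : evaluates nf_ring nf_elt phi -> equiv u (sval (phi u)).
Proof.
move=> [[phit phiq phi0 phi1] phiE].
elim: u => [v|a iha b ihb c ihc|a iha b ihb c ihc||].
- by have [i [a ->]] := Leaf_elt v; rewrite phiE; exact: rst_refl.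
- rewrite phit; apply: rst_trans (equiv_t iha ihb ihc) _.
  exact/graph_equiv_t/nf_tP.
- rewrite phiq; apply: rst_trans (equiv_q iha ihb ihc) _.
  exact/graph_equiv_q/nf_qP.
- by rewrite phi0; apply/equiv_step/rw_root; constructor.
- by rewrite phi1; apply/equiv_step/rw_root; constructor.
Qed.

(** This takes the place of confluence. By induction the arguments evaluate to themselves, and
    [graph_fun_t] or [graph_inj_q] then leaves the irreducible term itself as the only possible
    result. *)
Lemma nf_irr phi u : evaluates nf_ring nf_elt phi -> irr u -> sval (phi u) = u.
Proof.
move=> [[phit phiq _ _] phiE].
elim: u => [v _|a iha b ihb c ihc h|a iha b ihb c ihc h|/irr_N0 //|/irr_N1 //].
- by have [i [a ->]] := Leaf_elt v; rewrite phiE.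
- have /irr_TtP[/iha ea /ihb eb /ihc ec _] := h.
  have := nf_tP (phi a) (phi b) (phi c); rewrite phit ea eb ec /=.
  exact: graph_fun_t.
- have /irr_TqP[/iha ea /ihb eb /ihc ec _] := h.
  have := nf_qP (phi a) (phi b) (phi c); rewrite phiq ea eb ec /=.
  exact: graph_inj_q.
Qed.

(** * Comparison with the free product *)

Lemma normal_form_exists_unique (C : Type) (SC : ternary_ring C)
    (iota : forall i, A i -> C) (alpha : C) :
  is_amalgamated_free_product SA BA SC iota ->
  exists! tau, is_normal_form SA SC iota alpha tau.
Proof.
move=> [cC univ].
have [ev evP] := evaluates_exists cC.
have [evN evNP] := evaluates_exists nf_cocone.
have [f [fh fi _]] := univ _ _ _ nf_cocone.
have fev u : f (ev u) = evN u.
  apply: (evaluates_unique _ evNP (phi := f \o ev)).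
  exact: evaluates_hom fh fi evP.
(* Terms with equal values in [C] have, through [f], the same irreducible term as value in
   [nf_ring], and each is equivalent to that term. *)
have ev_equiv u v : ev u = ev v <-> equiv u v.
  split=> [e|]; last exact: evaluates_equiv cC evP.
  apply: rst_trans (nf_equiv u evNP) _.
  by rewrite -fev e fev; exact/rst_sym/nf_equiv.
have gh : is_hom nf_ring SC (fun a => ev (sval a)).
  have [[evt evq ev0 ev1] evE] := evP.
  split=> [a b c|a b c||] /=.
  - rewrite -evt; apply/ev_equiv/rst_sym; exact/graph_equiv_t/nf_tP.
  - rewrite -evq; apply/ev_equiv/rst_sym; exact/graph_equiv_q/nf_qP.
  - by rewrite -ev0; apply/ev_equiv/rst_sym/equiv_step/rw_root; constructor.
  - by rewrite -ev1; apply/ev_equiv/rst_sym/equiv_step/rw_root; constructor.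
(* Both this composite and the identity are endomorphisms of [C] compatible with [iota], so the
   universal property identifies them; hence [ev] is surjective. *)
have gf a : ev (sval (f a)) = a.
  have [k [_ _ uniq]] := univ _ _ _ cC.
  have gi i b : ev (sval (f (iota i b))) = iota i b.
    by rewrite fi /=; have [_ ->] := evP.
  transitivity (k a); first exact: (uniq _ (is_hom_comp fh gh) gi a).
  exact/esym/(uniq id (is_hom_id _)).
have iso : is_quotient_iso SA SC iota ev.
  have [? ?] := evP; split=> //; split=> // a.
  by exists (sval (f a)).
exists (sval (f alpha)); split.
  by split; [exists ev | exact: svalP].
move=> tau [[phi [[phih [phiE _ _]] <-]] tau_irr].
(* The map [phi] may differ a priori from [ev], but both extend [iota]; the irreducible [tau] is
   then its own value under [evN]. *)
rewrite (evaluates_unique (conj phih phiE) evP) fev.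
exact: nf_irr evNP tau_irr.
Qed.

End Amalgam.

Theorem theorem3p2 (I U : Type) (A : I -> set U) (B : set U)
    (SA : forall i, ternary_ring (A i)) (SB : ternary_ring B)
    (I_nonempty : inhabited I)
    (BA : forall i, B `<=` A i)
    (B_subalgebra : forall i, is_hom SB (SA i) (incl (BA i)))
    (A_meet : forall i j, i <> j -> A i `&` A j = B)
    (C : Type) (SC : ternary_ring C) (iota : forall i, A i -> C)
    (C_free_product : is_amalgamated_free_product SA BA SC iota) :
  forall alpha : C, exists! tau : uterm A, is_normal_form SA SC iota alpha tau.
Proof.
case: I_nonempty => i0 alpha.
exact (normal_form_exists_unique i0 B_subalgebra A_meet alpha C_free_product).
Qed.
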